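(* For every finite graph $G$, $\mathrm{box}(G)\le 2\,\mathrm{wcol}^*_2(G)$.
   Context: Graphs are finite and simple. The boxicity $\mathrm{box}(G)$ is the smallest $k$ such that $G$ is the intersection (same vertex set, intersection of edge sets) of $k$ interval graphs. For a linear order $\pi$ on $V(G)$ and an integer $r\ge0$, a vertex $u$ is weakly $r$-reachable from a vertex $v$ (with respect to $\pi$) if there is a path $P$ in $G$ of length (number of edges) at most $r$ between $u$ and $v$ such that $u\le_\pi x$ for every vertex $x$ of $P$. The parameter $\mathrm{wcol}^*_r(G)$ is the minimum $k$ such that for some linear order $\pi$ on $V(G)$ there is a coloring of $V(G)$ with $k$ colors such that for every vertex $v$, every vertex $u\neq v$ weakly $r$-reachable from $v$ has a color distinct from that of $v$. *)

(* Defs.v *)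
From HB Require Import structures.
From mathcomp Require Import all_boot all_order all_algebra.
From mathcomp Require Import boolp reals.

Set Implicit Arguments.
Unset Strict Implicit.
Unset Printing Implicit Defensive.

Import Order.TTheory GRing.Theory Num.Theory.

Record sgraph (V : finType) := SGraph {
  edge :> rel V;
  edge_sym : symmetric edge;
  edge_irr : irreflexive edge
}.

(** The condition [l v <= r v] makes all intervals nonempty. *)
Definition interval_graph (R : realType) (V : finType) (H : sgraph V) : Prop :=
  exists l r : V -> R,
    (forall v, (l v <= r v)%R) /\
    (forall u v, u != v ->
       H u v <-> exists x : R, x \in `[l u, r u]%R /\ x \in `[l v, r v]%R).

(** For [k = 0] the empty intersection is the complete graph on [V]; this is
    why the edge condition is restricted to distinct vertices.  In particular
    complete graphs have boxicity 0. *)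
Definition inter_interval_graphs (R : realType) (V : finType) (G : sgraph V)
    (k : nat) : Prop :=
  exists H : 'I_k -> sgraph V,
    (forall i, interval_graph R (H i)) /\
    (forall u v, u != v -> G u v = [forall i, H i u v]).

(** [missing_at G w], the graph whose only non-edges are the non-edges of [G] at
    [w], is an interval graph; the intersection of these graphs over all [w] is
    [G], so that boxicity is well defined. *)
Definition missing_at_rel (V : finType) (G : sgraph V) (w : V) : rel V := fun u v =>
  [&& u != v, (u == w) ==> G w v & (v == w) ==> G w u].

Lemma missing_at_sym (V : finType) (G : sgraph V) (w : V) :
  symmetric (missing_at_rel G w).
Proof. by move=> u v; rewrite /missing_at_rel eq_sym [X in _ && X]andbC. Qed.

Lemma missing_at_irr (V : finType) (G : sgraph V) (w : V) :
  irreflexive (missing_at_rel G w).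
Proof. by move=> u; rewrite /missing_at_rel eqxx. Qed.

Definition missing_at (V : finType) (G : sgraph V) (w : V) : sgraph V :=
  SGraph (missing_at_sym G w) (missing_at_irr G w).

Lemma missing_at_interval (R : realType) (V : finType) (G : sgraph V) (w : V) :
  interval_graph R (missing_at G w).
Proof.
exists (fun v => if (v == w) || G w v then 0 else 1)%R.
exists (fun v => if v == w then 0 else 1)%R.
split=> [v|u v neq_uv].
  by case: (v == w) => //=; case: (G w v).
rewrite /= /missing_at_rel neq_uv /=.
case: (eqVneq u w) => [uw|_] /=; case: (eqVneq v w) => [vw|_] /=.
- by move: neq_uv; rewrite uw vw eqxx.
- rewrite andbT; case: (G w v); split=> //.
    by exists 0%R; rewrite !in_itv /= lexx ler01.
  case=> x; rewrite !in_itv /= => -[/andP[_ x0] /andP[x1 _]].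
  by have := le_trans x1 x0; rewrite ler10.
- case: (G w u); split=> //.
    by exists 0%R; rewrite !in_itv /= lexx ler01.
  case=> x; rewrite !in_itv /= => -[/andP[x1 _] /andP[_ x0]].
  by have := le_trans x1 x0; rewrite ler10.
- split=> // _; exists 1%R; rewrite !in_itv /=.
  by split; case: ifP; rewrite ?lexx ?ler01.
Qed.

Lemma inter_interval_graphs_card (R : realType) (V : finType) (G : sgraph V) :
  inter_interval_graphs R G #|V|.
Proof.
exists (fun i => missing_at G (enum_val i)); split.
  by move=> i; exact: missing_at_interval.
move=> u v neq_uv; apply/idP/forallP => [Guv i|/(_ (enum_rank u))].
  rewrite /= /missing_at_rel neq_uv /=.
  apply/andP; split; apply/implyP=> /eqP <- //.
  by rewrite edge_sym.
by rewrite /= /missing_at_rel enum_rankK eqxx => /and3P[].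
Qed.

Lemma boxicity_exists (R : realType) (V : finType) (G : sgraph V) :
  exists k, `[< inter_interval_graphs R G k >].
Proof.
by exists #|V|; apply/asboolP; exact: inter_interval_graphs_card.
Qed.

Definition boxicity (R : realType) (V : finType) (G : sgraph V) : nat :=
  ex_minn (boxicity_exists R G).

Definition linear_order (V : finType) (le : rel V) : Prop :=
  [/\ reflexive le, antisymmetric le, transitive le & total le].

(** The vertices of the path from [v] to [u] are those of [v :: p], and its
    number of edges is [size p]. *)
Definition weakly_reachable (V : finType) (G : sgraph V) (le : rel V) (r : nat)
    (v u : V) : Prop :=
  exists p : seq V,
    [/\ path G v p, uniq (v :: p), last v p = u, size p <= r &
        {in v :: p, forall x, le u x}].

Definition wcol_star_colorable (V : finType) (G : sgraph V) (r k : nat) : Prop :=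
  exists le : rel V, linear_order le /\
  exists c : V -> 'I_k,
    forall v u, u != v -> weakly_reachable G le r v u -> c u != c v.

Lemma wcol_star_exists (V : finType) (G : sgraph V) (r : nat) :
  exists k, `[< wcol_star_colorable G r k >].
Proof.
exists #|V|; apply/asboolP.
exists (fun x y => enum_rank x <= enum_rank y); split.
  split=> [x|x y|y x z|x y]; first exact: leqnn.
  - by move=> /anti_leq /val_inj /enum_rank_inj.
  - exact: leq_trans.
  - exact: leq_total.
exists (@enum_rank V) => v u neq_uv _.
by apply: contra_neq neq_uv => /enum_rank_inj.
Qed.

Definition wcol_star (V : finType) (G : sgraph V) (r : nat) : nat :=
  ex_minn (wcol_star_exists G r).

(* Main.v *)
Require Import Defs.
From mathcomp Require Import all_boot all_order all_algebra.
From mathcomp Require Import boolp reals.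

(** Fix an order and a colouring witnessing [wcol_star G 2].  For a colour class
    [C], represent each vertex of [C] by the point given by its rank, and every
    other vertex by the interval from 0 to the largest rank of its neighbours in
    [C]; do the same with the reversed order.  Both interval graphs contain [G].
    Let [u < v] be non-adjacent with [u] in [C].  If neither graph separates
    them, then [v] is outside [C] and has neighbours [a < u < b] in [C], so the
    path [b - v - a] makes [a] weakly 2-reachable from [b], although both have
    the same colour. *)

Set Implicit Arguments.
Unset Strict Implicit.
Unset Printing Implicit Defensive.

Import Order.TTheory GRing.Theory Num.Theory.

Lemma boxicity_leq (R : realType) (V : finType) (G : sgraph V) k :
  inter_interval_graphs R G k -> boxicity R G <= k.
Proof.
by move=> Gk; rewrite /boxicity; case: ex_minnP => m _; apply; apply/asboolP.
Qed.

Lemma wcol_star_colorable_wcol_star (V : finType) (G : sgraph V) r :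
  wcol_star_colorable G r (wcol_star G r).
Proof. by rewrite /wcol_star; case: ex_minnP => k /asboolP. Qed.

Lemma inter_interval_graphs_fin (R : realType) (V I : finType) (G : sgraph V)
    (H : I -> sgraph V) :
  (forall i, interval_graph R (H i)) ->
  (forall u v, u != v -> G u v = [forall i, H i u v]) ->
  inter_interval_graphs R G #|I|.
Proof.
move=> intH GH; exists (fun i => H (enum_val i)); split=> // u v neq_uv.
rewrite GH //; apply/forallP/forallP => [Huv i //|Huv i].
by rewrite -(enum_rankK i).
Qed.

Lemma interval_graph_nat (R : realType) (V : finType) (H : sgraph V)
    (l r : V -> nat) :
  (forall v, l v <= r v) ->
  (forall u v, u != v -> H u v = (l u <= r v) && (l v <= r u)) ->
  interval_graph R H.
Proof.
move=> lr HE; exists (fun v => (l v)%:R%R), (fun v => (r v)%:R%R).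
split=> [v|u v neq_uv]; first by rewrite ler_nat.
rewrite HE //; split=> [/andP[luv lvu]|[x []]].
  exists (maxn (l u) (l v))%:R%R; rewrite !in_itv /= !ler_nat.
  by rewrite !geq_max leq_maxl leq_maxr lr luv lvu lr.
rewrite !in_itv /= => /andP[lu ru] /andP[lv rv].
by rewrite -!(ler_nat R) (le_trans lu rv) (le_trans lv ru).
Qed.

Section SweepGraph.

Variables (V : finType) (G : sgraph V) (le : rel V) (C : pred V).

(** The right end of the interval of [v] reaches the point [u], expressed through the order alone:
    the largest neighbour of [v] in [C] is at least [u]. *)
Definition sees (v u : V) : bool := [exists w, [&& C w, G v w & le u w]].

(** The intersection pattern of the intervals: distinct points never meet, two intervals of vertices
    outside [C] share 0, and the mixed case is decided by [sees]. *)
Definition sweep_rel : rel V := fun u v =>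
  (u != v) && (if C u then ~~ C v && sees v u else C v ==> sees u v).

Lemma sweep_sym : symmetric sweep_rel.
Proof.
by move=> u v; rewrite /sweep_rel eq_sym; case: (C u); case: (C v).
Qed.

Lemma sweep_irr : irreflexive sweep_rel.
Proof. by move=> u; rewrite /sweep_rel eqxx. Qed.

Definition sweep : sgraph V := SGraph sweep_sym sweep_irr.

(** For an edge with one end in [C], that end is itself the witness that the other end's interval
    reaches it; independence of [C] rules out edges between two points. *)
Lemma edge_sweep : reflexive le -> (forall u v, C u -> C v -> ~~ G u v) ->
  forall u v, G u v -> sweep u v.
Proof.
move=> le_refl indepC u v Guv; rewrite /= /sweep_rel.
have -> : u != v by apply: contraTneq Guv => ->; rewrite edge_irr.
case Cu: (C u); case Cv: (C v) => //=.
- by have := indepC _ _ Cu Cv; rewrite Guv.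
- by apply/existsP; exists u; rewrite Cu edge_sym Guv le_refl.
- by apply/existsP; exists v; rewrite Cv Guv le_refl.
Qed.

(** Since [v] counts itself, ranks start at 1, which keeps 0 free as the common left end. *)
Definition rank (v : V) : nat := #|[pred x | le x v]|.

Hypothesis leL : linear_order le.

Lemma leq_rank u v : (rank u <= rank v) = le u v.
Proof.
have [le_refl le_anti le_trans le_tot] := leL.
apply/idP/idP => [|le_uv]; last first.
  by apply/subset_leq_card/subsetP => x; rewrite !inE => /le_trans; apply.
apply: contraLR => nle_uv; rewrite -ltnNge; apply/proper_card/properP; split.
  have le_vu : le v u by have := le_tot u v; rewrite (negPf nle_uv).
  by apply/subsetP => x; rewrite !inE => /le_trans; apply.
by exists u; rewrite !inE.
Qed.

Lemma rank_gt0 v : 0 < rank v.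
Proof. by case: leL => le_refl _ _ _; apply/card_gt0P; exists v; rewrite inE. Qed.

(** The maximum over an empty set is 0, below every rank, so a vertex without neighbours in [C] gets
    an interval that meets no point. *)
Lemma leq_rank_bigmax u v :
  (rank u <= \max_(w | C w && G v w) rank w) = sees v u.
Proof.
apply/idP/existsP => [|[w /and3P[Cw Gvw le_uw]]]; last first.
  by apply: (bigop.bigmax_sup w); rewrite ?Cw ?leq_rank.
apply: contraPP => Nsees; apply/negP; rewrite -ltnNge.
rewrite -(prednK (rank_gt0 u)) ltnS; apply/bigmax_leqP => w /andP[Cw Gvw].
rewrite -ltnS (prednK (rank_gt0 u)) ltnNge leq_rank.
by apply/negP => le_uw; apply: Nsees; exists w; rewrite Cw Gvw.
Qed.

Lemma sweep_interval (R : realType) : interval_graph R sweep.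
Proof.
pose l v := if C v then rank v else 0.
pose r v := if C v then rank v else \max_(w | C w && G v w) rank w.
apply: (@interval_graph_nat _ _ _ l r) => [v|u v neq_uv]; rewrite /l /r.
  by case: (C v).
rewrite /= /sweep_rel neq_uv /=; case: (C u); case: (C v) => //=.
- rewrite !leq_rank; apply/esym/negbTE; apply: contra neq_uv => le_uvu.
  by case: leL => _ le_anti _ _; apply/eqP/le_anti.
- by rewrite leq_rank_bigmax andbT.
- by rewrite leq_rank_bigmax.
Qed.

End SweepGraph.

Lemma linear_order_flip (V : finType) (le : rel V) :
  linear_order le -> linear_order (fun x y => le y x).
Proof.
case=> le_refl le_anti le_trans le_tot; split=> [x|x y|y x z|x y] //.
- by rewrite andbC => /le_anti.
- by move=> le_yx le_zy; apply: le_trans le_yx.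
Qed.

Section Reachable.

Variables (V : finType) (G : sgraph V) (le : rel V).
Hypothesis le_refl : reflexive le.

Lemma weakly_reachable_edge u v r : G v u -> le u v ->
  weakly_reachable G le r.+1 v u.
Proof.
move=> Gvu le_uv; exists [:: u]; split=> //=; first by rewrite Gvu.
  by rewrite inE andbT; apply: contraTneq Gvu => ->; rewrite edge_irr.
by move=> x; rewrite !inE => /orP[] /eqP ->.
Qed.

Lemma weakly_reachable_cherry u v w r : u != v -> G v w -> G w u ->
  le u v -> le u w -> weakly_reachable G le r.+2 v u.
Proof.
move=> neq_uv Gvw Gwu le_uv le_uw.
exists [:: w; u]; split=> //=; first by rewrite Gvw Gwu.
  rewrite !inE negb_or (eq_sym v u) neq_uv !andbT.
  by apply/andP; split; [apply: contraTneq Gvw | apply: contraTneq Gwu];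
    move=> ->; rewrite edge_irr.
by move=> x; rewrite !inE => /or3P[] /eqP ->.
Qed.

End Reachable.

Lemma wcol_star_colorable_inter (R : realType) (V : finType) (G : sgraph V) k :
  wcol_star_colorable G 2 k -> inter_interval_graphs R G (2 * k).
Proof.
case=> le [leL [c c_ok]]; have [le_refl le_anti le_trans le_tot] := leL.
pose ord (b : bool) : rel V := if b then le else fun x y => le y x.
have ordL b : linear_order (ord b).
  by case: b => //; apply: linear_order_flip.
pose H (i : bool * 'I_k) := sweep G (ord i.1) (fun v => c v == i.2).
have -> : 2 * k = #|{: bool * 'I_k}| by rewrite card_prod card_bool card_ord.
(* The smaller end of an edge is weakly reachable from the larger one, so colour classes are
   independent. *)
have edge_color u v : G u v -> c u != c v.
  wlog le_uv : u v / le u v => [wl|Guv].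
    by case/orP: (le_tot u v) => /wl // wl'; rewrite edge_sym eq_sym.
  apply: c_ok; first by apply: contraTneq Guv => ->; rewrite edge_irr.
  by apply: weakly_reachable_edge => //; rewrite edge_sym.
apply: (@inter_interval_graphs_fin _ _ _ _ H) => [i|u v neq_uv].
  exact: sweep_interval.
apply/idP/forallP => [Guv [b j]|].
  apply: edge_sweep Guv => [x|x y /eqP cx /eqP cy]; first by case: (ordL b).
  by apply/negP => /edge_color; rewrite cx cy eqxx.
wlog le_uv : u v neq_uv / le u v => [wl Huv|Huv].
  case/orP: (le_tot u v) => [/wl|/wl wl']; first exact.
  by rewrite edge_sym; apply: wl' => [|i]; rewrite 1?eq_sym 1?edge_sym.
(* Only the class of the smaller vertex [u] is needed; its two directions give neighbours [a] below
   and [b] above [u]. *)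
have := Huv (true, c u); have := Huv (false, c u).
rewrite /= /sweep_rel neq_uv eqxx /=.
move=> /andP[_ /existsP[a /and3P[/eqP ca Gva le_au]]].
move=> /andP[_ /existsP[b /and3P[/eqP cb Gvb le_ub]]].
(* The bounds on [a] and [b] are not strict: if the two coincide, both equal [u], and [v] is
   adjacent to [u] as required. *)
have [ab|neq_ab] := eqVneq a b.
  by rewrite edge_sym (le_anti u a) ?le_au ?ab ?le_ub // -ab.
have : c a != c b; last by rewrite ca cb eqxx.
(* Here [u] below [v] matters: it puts [a] below the middle vertex [v] of the path. *)
apply: (c_ok b a neq_ab); apply: (@weakly_reachable_cherry _ _ _ _ _ _ v) => //.
- by rewrite edge_sym.
- exact: le_trans le_ub.
- exact: le_trans le_uv.
Qed.

Theorem theorem4 (R : realType) (V : finType) (G : sgraph V) :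
  boxicity R G <= 2 * wcol_star G 2.
Proof.
apply: boxicity_leq; apply: wcol_star_colorable_inter.
exact: wcol_star_colorable_wcol_star.
Qed.
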